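(* Let $\mathbb{P}$ be a semifield, let $(B,\mathbf{x},\mathbf{y})$ be a seed over $\mathbb{P}$, and let $\mathbb{A}$ be a ground ring with $\mathbb{Z}\subseteq\mathbb{A}\subseteq\mathbb{Z}\mathbb{P}$ satisfying the standing assumptions (i) and (ii) of the context. If $\mathbb{A}$ is a normal domain, then the upper cluster algebra $\mathcal{U}_{\mathbb{A}}=\mathcal{U}_{\mathbb{A}}(B,\mathbf{x},\mathbf{y})$ is a normal domain.
   Context: An integral domain is a normal domain if it is integrally closed in its field of fractions. A semifield $\mathbb{P}$ is a torsion-free abelian group, written multiplicatively, with an auxiliary addition $\oplus$ that is commutative, associative and distributive over the multiplication. $\mathbb{Z}\mathbb{P}$ is its group ring. Let $\mathcal{F}$ be a field containing $\mathbb{Z}\mathbb{P}$. A seed of rank $n$ in $\mathcal{F}$ is a triple $(B,\mathbf{x},\mathbf{y})$ where $\mathbf{x}=(x_1,\dots,x_n)$ (the cluster) is an $n$-tuple in $\mathcal{F}$ freely generating $\mathcal{F}$ as a field over the fraction field of $\mathbb{Z}\mathbb{P}$, $\mathbf{y}=(y_1,\dots,y_n)$ (the coefficients) is an $n$-tuple in $\mathbb{P}$, and $B$ (the exchange matrix) is an integral skew-symmetrizable $n\times n$ matrix. Mutation. Write $[a]_+=\max(a,0)$. For $1\le k\le n$ the mutation of a seed in direction $k$ is the seed $(\mu_k(B),\mu_k(\mathbf{x}),\mu_k(\mathbf{y}))$, where $\mu_k(\mathbf{x})$ is obtained from $\mathbf{x}$ by replacing $x_k$ with $x_k'=\dfrac{y_k\prod_j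 x_j^{[B_{jk}]_+}+\prod_j x_j^{[-B_{jk}]_+}}{(y_k\oplus 1)x_k}$; $\mu_k(\mathbf{y})=(y_1',\dots,y_n')$ with $y_k'=y_k^{-1}$ and $y_i'=y_iy_k^{[B_{ki}]_+}(y_k\oplus 1)^{-B_{ki}}$ for $i\ne k$; and $\mu_k(B)_{ij}=-B_{ij}$ if $i=k$ or $j=k$, and $\mu_k(B)_{ij}=B_{ij}+\frac12(|B_{ik}|B_{kj}+B_{ik}|B_{kj}|)$ otherwise. Two seeds are mutation equivalent if one is obtained from the other by a sequence of mutations, up to permuting indices. Cluster algebras. The cluster variables are the elements of the clusters of all seeds mutation equivalent to $(B,\mathbf{x},\mathbf{y})$. For a ground ring $\mathbb{Z}\subseteq\mathbb{A}\subseteq\mathbb{Z}\mathbb{P}$, the cluster algebra $\mathcal{A}=\mathcal{A}_{\mathbb{A}}(B,\mathbf{x},\mathbf{y})$ is the unital $\mathbb{A}$-subalgebra of $\mathcal{F}$ generated by all cluster variables, and the upper cluster algebra is $\mathcal{U}=\mathcal{U}_{\mathbb{A}}(B,\mathbf{x},\mathbf{y})=\bigcap \mathbb{A}[(x_1')^{\pm1},\dots,(x_n')^{\pm1}]$, the intersection over all clusters $(x_1',\dots,x_n')$ of seeds mutation equivalent to $(B,\mathbf{x},\mathbf{y})$. Standing assumptions on $\mathbb{A}$. For every seed $(B',\mathbf{x}',\mathbf{y}')$ mutation equivalent to the given one: (i) (Laurent phenomenon over $\mathbb{A}$) $\mathcal{A}\subseteq\mathcal{A}[(x_1')^{-1},\dots,(x_n')^{-1}]=\mathbb{A}[(x_1')^{\pm1},\dots,(x_n')^{\pm1}]$;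 (ii) $\frac{y_i'}{1\oplus y_i'},\frac{1}{1\oplus y_i'}\in\mathbb{A}$ for all $i$. *)

(* Defs.v *)
From HB Require Import structures.
From mathcomp Require Import all_boot all_order all_algebra.
From mathcomp Require Import perm finmap monalg.
From mathcomp Require Import boolp classical_sets.

Set Implicit Arguments.
Unset Strict Implicit.
Unset Printing Implicit Defensive.

Import GRing.Theory Num.Theory.

Local Open Scope classical_set_scope.
Local Open Scope ring_scope.

Reserved Notation "p ⊕ q" (at level 50, left associativity).

(** * Semifields *)

HB.mixin Record Group_isSemifield P of monoid.Group P := {
  sf_mulC : commutative (fun p q : P => (p * q)%g);
  sf_torsion_free : forall (p : P) (m : nat),
    (0 < m)%N -> (p ^+ m = 1)%g -> p = 1%g;
  sf_add : P -> P -> P;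
  sf_addC : commutative sf_add;
  sf_addA : associative sf_add;
  sf_mulDl : left_distributive (fun p q : P => (p * q)%g) sf_add
}.

#[short(type="semifieldType")]
HB.structure Definition Semifield := { P of monoid.Group P & Group_isSemifield P }.

Notation "p ⊕ q" := (sf_add p q) : group_scope.

(** * The integral group ring *)

(* [{malg int[G]}] (finitely supported functions [G -> int]) only carries the
   convolution product when [G] is a [monomType], a class of monoids that
   excludes nontrivial groups; the product is therefore redefined here. *)
Section GroupRing.
Variable G : groupType.

Definition group_ring : Type := {malg int[G]}.
HB.instance Definition _ := GRing.Zmodule.on group_ring.

Implicit Types (f g h : {malg int[G]}) (p q : G).

Definition gr_one : {malg int[G]} := mkmalgU 1%g 1.
Definition gr_mul f g : {malg int[G]} :=
  \sum_(p <- msupp f) \sum_(q <- msupp g) mkmalgU (p * q)%g (f@_p * g@_q).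

Lemma gr_mulw (d1 d2 : {fset G}) f g :
  (msupp f `<=` d1)%fset -> (msupp g `<=` d2)%fset ->
  gr_mul f g =
    \sum_(p <- d1) \sum_(q <- d2) mkmalgU (p * q)%g (f@_p * g@_q).
Proof.
move=> le1 le2; rewrite /gr_mul (big_fset_incl _ le1) /=.
  apply/eq_bigr=> p _; apply/big_fset_incl => // q _ /mcoeff_outdom ->.
  by rewrite mulr0 monalgU0.
move=> p _ /mcoeff_outdom fp.
by rewrite big1 // => q _; rewrite fp mul0r monalgU0.
Qed.

Lemma gr_mulUU (a b : int) p q :
  gr_mul (mkmalgU p a) (mkmalgU q b) = mkmalgU (p * q)%g (a * b).
Proof. by rewrite (gr_mulw msuppU_le msuppU_le) !big_seq_fset1 !mcoeffUU. Qed.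

Lemma gr_mulDl : left_distributive gr_mul +%R.
Proof.
move=> f1 f2 g; rewrite (gr_mulw (msuppD_le f1 f2) (fsubset_refl _)).
rewrite (gr_mulw (fsubsetUl (msupp f1) (msupp f2)) (fsubset_refl _)).
rewrite (gr_mulw (fsubsetUr (msupp f1) (msupp f2)) (fsubset_refl _)).
rewrite -big_split /=; apply/eq_bigr=> p _.
rewrite -big_split /=; apply/eq_bigr=> q _.
by rewrite mcoeffD mulrDl monalgUD.
Qed.

Lemma gr_mulDr : right_distributive gr_mul +%R.
Proof.
move=> g f1 f2; rewrite (gr_mulw (fsubset_refl _) (msuppD_le f1 f2)).
rewrite (gr_mulw (fsubset_refl _) (fsubsetUl (msupp f1) (msupp f2))).
rewrite (gr_mulw (fsubset_refl _) (fsubsetUr (msupp f1) (msupp f2))).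
rewrite -big_split /=; apply/eq_bigr=> p _.
rewrite -big_split /=; apply/eq_bigr=> q _.
by rewrite mcoeffD mulrDr monalgUD.
Qed.

Lemma gr_mul0l : left_zero 0 gr_mul.
Proof. by move=> g; rewrite /gr_mul msupp0 big_seq_fset0. Qed.

Lemma gr_mul0r : right_zero 0 gr_mul.
Proof.
by move=> g; rewrite /gr_mul big1 // => p _; rewrite msupp0 big_seq_fset0.
Qed.

Lemma gr_mul_suml (I : Type) (r : seq I) (E : I -> {malg int[G]}) g :
  gr_mul (\sum_(i <- r) E i) g = \sum_(i <- r) gr_mul (E i) g.
Proof.
exact: (big_morph (gr_mul^~ g) (fun _ _ => gr_mulDl _ _ _) (gr_mul0l g)).
Qed.

Lemma gr_mul_sumr (I : Type) (r : seq I) (E : I -> {malg int[G]}) g :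
  gr_mul g (\sum_(i <- r) E i) = \sum_(i <- r) gr_mul g (E i).
Proof.
exact: (big_morph (gr_mul g) (fun _ _ => gr_mulDr _ _ _) (gr_mul0r g)).
Qed.

Lemma gr_mul1l : left_id gr_one gr_mul.
Proof.
move=> g; rewrite {1}[g]monalgE gr_mul_sumr [RHS]monalgE.
by apply/eq_bigr=> p _; rewrite gr_mulUU mul1r mul1g.
Qed.

Lemma gr_mul1r : right_id gr_one gr_mul.
Proof.
move=> g; rewrite {1}[g]monalgE gr_mul_suml [RHS]monalgE.
by apply/eq_bigr=> p _; rewrite gr_mulUU mulr1 mulg1.
Qed.

Lemma gr_mulA : associative gr_mul.
Proof.
move=> f g h; rewrite [f]monalgE !gr_mul_suml; apply/eq_bigr=> p _.
rewrite [g]monalgE gr_mul_suml !gr_mul_sumr gr_mul_suml.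
apply/eq_bigr=> q _.
rewrite [h]monalgE !gr_mul_sumr; apply/eq_bigr=> r _.
by rewrite !gr_mulUU mulrA mulgA.
Qed.

Lemma gr_one_neq0 : gr_one != 0.
Proof. by rewrite monalgU_eq0. Qed.

HB.instance Definition _ := GRing.Zmodule_isNzRing.Build group_ring
  gr_mulA gr_mul1l gr_mul1r gr_mulDl gr_mulDr gr_one_neq0.

Definition gr_elt p : group_ring := mkmalgU p 1.

Definition gexpz p (a : int) : G :=
  match a with Posz m => (p ^+ m)%g | Negz m => (p ^- m.+1)%g end.

End GroupRing.

(* Imported only now because its [_@__] notation shadows the one of [monalg],
   whose [{mpoly _[_]}] in turn shadows the one of [mpoly]. *)
From mathcomp Require Import mpoly.

(** * Subrings of a field *)

Section Subrings.
Variable F : fieldType.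

(* Smallest subring of [F] containing [R] and [X]. *)
Definition adjoin (R X : set F) : set F :=
  smallest [set S : set F | GRing.subring_closed (mem S)] (R `|` X).

(* The field of fractions, inside [F], of a subring of [F]. *)
Definition frac_field (R : set F) : set F :=
  [set u | exists2 a, R a & exists2 b, R b /\ b != 0 & u = a / b].

Definition integral_over (R : set F) (u : F) : Prop :=
  exists p : {poly F}, [/\ p \is monic, p \is a polyOver (mem R) & root p u].

(* As a subring of a field, [R] is automatically an integral domain. *)
Definition normal_domain (R : set F) : Prop :=
  GRing.subring_closed (mem R) /\
  (forall u, frac_field R u -> integral_over R u -> R u).

Definition algebraically_independent (K : set F) n (x : 'I_n -> F) : Prop :=
  forall p : mpoly n F, p \is a mpolyOver n (mem K) -> p.@[x] = 0 -> p = 0.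

Definition generates_field (K : set F) n (x : 'I_n -> F) : Prop :=
  smallest [set S : set F | GRing.divring_closed (mem S)]
    (K `|` range x) = [set: F].

Definition freely_generates (K : set F) n (x : 'I_n -> F) : Prop :=
  algebraically_independent K x /\ generates_field K x.

(* [R[x_1^{±1}, ..., x_n^{±1}]] *)
Definition laurent_ring (R : set F) n (x : 'I_n -> F) : set F :=
  adjoin R (range x `|` range (fun i => (x i)^-1)).

End Subrings.

(** * Seeds and mutation *)

Definition skew_symmetrizable n (B : 'M[int]_n) : Prop :=
  exists d : 'rV[int]_n,
    (forall i, 0 < d 0 i) /\ (diag_mx d *m B)^T = - (diag_mx d *m B).

Definition pos_part (a : int) : nat := `|Num.max a 0|%N.

Section Seeds.
Variables (P : semifieldType) (F : fieldType).
Variable iota : {rmorphism group_ring P -> F}.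
Variable n : nat.

Record seed := Seed {
  exchange_matrix : 'M[int]_n;
  cluster : 'I_n -> F;
  coefficients : 'I_n -> P
}.

Implicit Types (S : seed) (k : 'I_n).

Definition is_seed S : Prop :=
  skew_symmetrizable (exchange_matrix S) /\
  freely_generates (frac_field (range iota)) (cluster S).

Definition mutate_matrix k (B : 'M[int]_n) : 'M[int]_n :=
  \matrix_(i, j)
    if (i == k) || (j == k) then - B i j
    else B i j + ((`|B i k| * B k j + B i k * `|B k j|) %/ 2)%Z.

Definition mutate_cluster k S : 'I_n -> F :=
  let B := exchange_matrix S in
  let x := cluster S in
  let y := coefficients S in
  fun i =>
    if i == k then
      (iota (gr_elt (y k)) * \prod_j x j ^+ pos_part (B j k)
         + \prod_j x j ^+ pos_part (- B j k))
      / (iota (gr_elt (y k ⊕ 1)%g) * x k)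
    else x i.

Definition mutate_coefficients k (B : 'M[int]_n) (y : 'I_n -> P) : 'I_n -> P :=
  fun i =>
    if i == k then (y k)^-1%g
    else (y i * y k ^+ pos_part (B k i) * gexpz (y k ⊕ 1) (- B k i)%R)%g.

Definition mutate k S : seed :=
  Seed (mutate_matrix k (exchange_matrix S))
       (mutate_cluster k S)
       (mutate_coefficients k (exchange_matrix S) (coefficients S)).

Definition permute_seed (s : 'S_n) S : seed :=
  Seed (\matrix_(i, j) exchange_matrix S (s i) (s j))
       (cluster S \o s) (coefficients S \o s).

Definition mutation_equivalent S S' : Prop :=
  exists (ks : seq 'I_n) (s : 'S_n),
    S' = permute_seed s (foldl (fun T k => mutate k T) S ks).

Definition cluster_variables S : set F :=
  \bigcup_(S' in mutation_equivalent S) range (cluster S').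

Definition cluster_algebra (A : set (group_ring P)) S : set F :=
  adjoin (iota @` A) (cluster_variables S).

Definition upper_cluster_algebra (A : set (group_ring P)) S : set F :=
  \bigcap_(S' in mutation_equivalent S) laurent_ring (iota @` A) (cluster S').

Definition laurent_phenomenon (A : set (group_ring P)) S : Prop :=
  forall S', mutation_equivalent S S' ->
    let localized :=
      adjoin (cluster_algebra A S) (range (fun i => (cluster S' i)^-1)) in
    cluster_algebra A S `<=` localized /\
    localized = laurent_ring (iota @` A) (cluster S').

Definition coefficient_condition (A : set (group_ring P)) S : Prop :=
  forall S', mutation_equivalent S S' ->
    forall i, let y := coefficients S' i in
      A (gr_elt (y / (1 ⊕ y))%g) /\ A (gr_elt (1 ⊕ y)^-1%g).

End Seeds.

(* Main.v *)
Require Import Defs.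
From HB Require Import structures.
From mathcomp Require Import all_boot all_order all_algebra.
From mathcomp Require Import perm fieldext mpoly.
From mathcomp Require Import boolp classical_sets ring.

Set Implicit Arguments.
Unset Strict Implicit.
Unset Printing Implicit Defensive.

Import Order.TTheory GRing.Theory Num.Theory.

Local Open Scope classical_set_scope.
Local Open Scope ring_scope.

(** The upper cluster algebra is an intersection of Laurent rings inside one
    field, and an intersection of normal subrings of a field is normal
    ([bigcap_normal]).  So it is enough that the Laurent ring of every cluster
    is normal, and this needs two facts.

    First, if [R] is normal and [x] is algebraically independent over [R], then
    [R[x_1^{±1}, ..., x_n^{±1}]] is normal ([laurent_ring_normal]).  The
    variables are adjoined one at a time, so the matter is a single
    transcendental [x] ([laurent_extension_normal]).  After multiplication by a
    power of [x], an element of the fraction field that is integral over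
    [R[x^{±1}]] becomes a quotient [a / b] of polynomials over [R] that
    satisfies a monic equation over [R[x]].  By unique factorisation over the
    ambient field, [b] divides [a]; call the quotient [c] and let [q] be the
    monic polynomial over [R[X]] of which [c] is a root.  For [r] large,
    [X^r - c] is monic and divides [q(X^r)], which is monic over [R].  The roots
    of a monic factor of a monic polynomial over [R] are integral over [R],
    hence so are its coefficients ([monic_factor_integral]); being fractions
    over [R], they lie in [R] ([integrally_closed_poly]).

    Second, every cluster is algebraically independent over the group ring
    ([mutate_independent]).  Here the point is that the exchange relation is
    an involution on points: a polynomial relation between the mutated
    variables becomes, once denominators are cleared, a relation between the old
    ones, so the cleared polynomial [q] vanishes identically; evaluating [q] at
    the mutated point gives back the original polynomial at the old point
    ([exchange_free]).  The involution requires that the exchange binomial in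
    direction [k] does not involve [x_k], that is, [B_kk = 0], which is why
    skew-symmetrizability is carried along the mutations. *)

(** * Splitting a monic polynomial *)

Lemma irreducible_divisor (K : fieldType) (p : {poly K}) :
  (1 < size p)%N -> exists2 q, irreducible_poly q & q %| p.
Proof.
have [m] := ubnP (size p); elim: m p => // m IHm p lt_p_m p_gt1.
have [irr_p|red_p] := pselect (irreducible_poly p); first by exists p.
have [q [q_neq1 q_dvd nq_eq]] :
    exists q : {poly K}, [/\ size q != 1%N, q %| p & ~~ (q %= p)].
  apply: contrapT => /forallNP no_q; case: red_p; split=> // q q_neq1 q_dvd.
  by apply: contrapT => /negP nq_eq; apply: (no_q q).
have p_neq0 : p != 0 by rewrite -size_poly_gt0 ltnW.
have q_neq0 : q != 0.
  by apply: contraTneq q_dvd => ->; rewrite dvd0p.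
have q_gt1 : (1 < size q)%N.
  by rewrite ltn_neqAle eq_sym q_neq1 size_poly_gt0.
have lt_qp : (size q < size p)%N.
  rewrite ltn_neqAle dvdp_leq // andbT.
  by apply: contra nq_eq => szE; rewrite -(dvdp_size_eqp q_dvd).
have [r irr_r r_dvd] := IHm q (leq_trans lt_qp lt_p_m) q_gt1.
by exists r => //; apply: dvdp_trans q_dvd.
Qed.

(** The extension is only asked for as a field with a morphism into it, which
    makes the iterated adjunction of roots a plain composition of morphisms. *)
Lemma monic_splits (K : fieldType) (p : {poly K}) : p \is monic ->
  exists (L : fieldType) (phi : {rmorphism K -> L}) (rs : seq L),
    map_poly phi p = \prod_(z <- rs) ('X - z%:P).
Proof.
have [m] := ubnP (size p); elim: m K p => // m IHm K p lt_p_m mon_p.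
have [p_le1|p_gt1] := leqP (size p) 1.
  exists K, idfun, [::]; rewrite big_nil map_poly_id //.
  move: mon_p; rewrite (size1_polyC p_le1) monicE lead_coefC => /eqP -> //.
have [q irr_q q_dvd] := irreducible_divisor p_gt1.
have [L _ [z qz _]] := irredp_FAdjoin irr_q.
have /factor_theorem [r Dp] : root (map_poly (in_alg L) p) z.
  by rewrite -(divpK q_dvd) rmorphM rootM qz orbT.
have mon_r : r \is monic.
  have : map_poly (in_alg L) p \is monic by rewrite monic_map.
  by rewrite Dp monicMr ?monicXsubC.
have szr : size p = (size r).+1.
  by rewrite -(size_map_poly (in_alg L)) Dp size_Mmonic ?monicXsubC ?monic_neq0
     // size_XsubC addn2.
have lt_r_m : (size r < m)%N by rewrite szr ltnS in lt_p_m.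
have [M [psi [rs Dr]]] := IHm L r lt_r_m mon_r.
exists M, (psi \o in_alg L), (psi z :: rs).
rewrite map_poly_comp Dp rmorphM /= Dr rmorphB /= map_polyX map_polyC /=.
by rewrite big_cons mulrC.
Qed.

(** * Integrality over a subring of a field *)

Definition subring_of (F : fieldType) (R : set F)
    (HR : GRing.subring_closed (mem R)) : subringClosed F :=
  HB.pack (mem R : {pred F}) (GRing.isSubringClosed.Build F (mem R) HR).

(** The theory of [integralOver] speaks of ring morphisms, so the subring has to
    be a type with its inclusion rather than a predicate. *)
Record subring_elt (F : fieldType) (S : subringClosed F) :=
  SubringElt { elt_val :> F; _ : elt_val \in S }.

HB.instance Definition _ F S := [isSub for @elt_val F S].
HB.instance Definition _ (F : fieldType) (S : subringClosed F) :=
  [Choice of subring_elt S by <:].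
HB.instance Definition _ (F : fieldType) (S : subringClosed F) :=
  [SubChoice_isSubComNzRing of subring_elt S by <:].

Section Integral.
Variables (F : fieldType) (R : set F).
Hypothesis HR : GRing.subring_closed (mem R).
Let S := subring_of HR.

Let rho : {rmorphism subring_elt S -> F} := \val.

Lemma polyOver_lift (p : {poly F}) : p \is a polyOver (mem R) ->
  exists P, map_poly rho P = p.
Proof.
move=> Rp0; have /polyOverP Rp : p \is a polyOver S := Rp0.
exists (\poly_(i < size p) (SubringElt (Rp i : p`_i \in S))).
apply/polyP => i; rewrite coef_map coef_poly; case: ltnP => //= le_pi.
by rewrite nth_default.
Qed.

Lemma integralOver_integral_over u : integralOver rho u -> integral_over R u.
Proof.
case=> P mon_P Pu; exists (map_poly rho P); split=> //; first by rewrite monic_map.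
change (map_poly rho P \is a polyOver S).
by apply/polyOverP => i; rewrite coef_map /=; apply: (valP (P`_i)).
Qed.

(** In a splitting field the roots of [f] are roots of [h], hence integral, and
    the coefficients of [f] are sums of products of them. *)
Lemma monic_factor_integral (f h : {poly F}) :
  f \is monic -> h \is monic -> h \is a polyOver (mem R) -> f %| h ->
  forall i, integral_over R f`_i.
Proof.
move=> mon_f mon_h /polyOver_lift[H DH] f_dvd_h i; apply: integralOver_integral_over.
have [L [phi [rs Df]]] := monic_splits mon_f.
pose sig : {rmorphism subring_elt S -> L} := phi \o rho.
have int_rs z : z \in rs -> integralOver sig z.
  move=> rs_z; exists H.
    apply/monicP/(val_inj : injective rho).
    by rewrite -lead_coef_map_inj ?DH ?rmorph1 ?(monicP mon_h)//; apply: val_inj.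
  rewrite map_poly_comp DH; have /dvdpP[g ->] := f_dvd_h.
  by rewrite rmorphM rootM /= Df root_prod_XsubC rs_z orbT.
have int_prod : forall j, integralOver sig (\prod_(z <- rs) ('X - z%:P))`_j.
  elim: rs int_rs {Df} => [_ j|z rs IHrs int_rs j].
    by rewrite big_nil coef1; apply: integral_nat.
  rewrite big_cons mulrBl coefB coefXM mul_polyC coefZ.
  have int_IH : forall k, integralOver sig (\prod_(z <- rs) ('X - z%:P))`_k.
    by apply: IHrs => t rs_t; apply: int_rs; rewrite inE rs_t orbT.
  apply: integral_sub.
    by case: eqP => _; [apply: integral0 | apply: int_IH].
  by apply: integral_mul => //; apply: int_rs; rewrite mem_head.
have [P mon_P] : integralOver sig (phi f`_i) by rewrite -coef_map Df.
by rewrite map_poly_comp fmorph_root; exists P.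
Qed.

End Integral.

(** * Monic equations over polynomials *)

Section NormalPoly.
Variables (F : fieldType) (R : set F).

(** Pseudo-division of [a] by [b] only divides by the leading coefficient of
    [b]; its remainder vanishes because [b] divides [a] over the field. *)
Lemma quotient_frac_coef (a b c : {poly F}) :
  GRing.subring_closed (mem R) -> a \is a polyOver (mem R) ->
  b \is a polyOver (mem R) -> b != 0 -> a = b * c ->
  forall i, frac_field R c`_i.
Proof.
move=> HR /(polyOver_lift HR)[A <-] /(polyOver_lift HR)[B <-] b_neq0 Dc i.
pose S := subring_of HR; pose rho : {rmorphism subring_elt S -> F} := \val.
have rho_inj : injective rho by apply: val_inj.
have B_neq0 : B != 0 by apply: contraNneq b_neq0 => ->; rewrite rmorph0.
have Dlead := lead_coef_map_inj rho_inj (rmorph0 rho).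
set l := lead_coef B ^+ Pdiv.Ring.rscalp A B.
have l_neq0 : rho l != 0.
  by rewrite rmorphXn expf_neq0 // -Dlead lead_coef_eq0.
have /(congr1 (map_poly rho)) := Pdiv.ComRing.rdivp_eq B A.
rewrite linearZ_LR rmorphD rmorphM /= -/l -/rho Dc => DlA.
set Q := map_poly rho (Pdiv.Ring.rdivp A B) in DlA.
set M := map_poly rho (Pdiv.Ring.rmodp A B) in DlA.
have DM : M = map_poly rho B * (rho l *: c - Q).
  by rewrite mulrBr -scalerAr DlA [_ * Q]mulrC addrC addKr.
have ltMB : (size M < size (map_poly rho B))%N.
  by rewrite !size_map_inj_poly //; rewrite Pdiv.Ring.ltn_rmodp.
have DQ : rho l *: c = Q.
  apply/eqP; rewrite -subr_eq0; apply: contraTT ltMB => nz.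
  by rewrite -leqNgt DM size_mul // -ltnS prednK ?addn_gt0 ?size_poly_gt0 ?nz ?orbT
     // -addn1 leq_add2l size_poly_gt0.
exists (rho (Pdiv.Ring.rdivp A B)`_i).
  exact: set_mem (valP (Pdiv.Ring.rdivp A B)`_i).
exists (rho l).
  by split=> //; exact: set_mem (valP l).
by rewrite -[rho _`_i]coef_map -/Q -DQ coefZ mulrAC divff ?mul1r.
Qed.

(** This is the rational root argument for a homogenised monic equation, in the
    factorial ring [{poly F}]: modulo the denominator, the equation leaves only
    the top power of the numerator. *)
Lemma dvdp_of_integral_eqn (a b : {poly F}) (q : {poly {poly F}}) :
  b != 0 -> q \is monic ->
  \sum_(i < size q) q`_i * a ^+ i * b ^+ ((size q).-1 - i) = 0 -> b %| a.
Proof.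
move=> b_neq0 mon_q; have q_gt0 : (0 < size q)%N.
  by rewrite size_poly_gt0 monic_neq0.
have lead_q : q`_(size q).-1 = 1 by apply/eqP; rewrite -monicE.
move: (size q) q_gt0 lead_q => [//|d] _ /= lead_q.
set g := gcdp a b; pose a1 := a %/ g; pose b1 := b %/ g.
have Da : a = a1 * g by rewrite divpK ?dvdp_gcdl.
have Db : b = b1 * g by rewrite divpK ?dvdp_gcdr.
have g_neq0 : g != 0 by rewrite gcdp_eq0 negb_and b_neq0 orbT.
have co_b1a1 : coprimep b1 a1.
  by rewrite coprimep_sym coprimep_div_gcd ?b_neq0 ?orbT.
have -> : \sum_(i < d.+1) q`_i * a ^+ i * b ^+ (d - i) =
          g ^+ d * \sum_(i < d.+1) q`_i * a1 ^+ i * b1 ^+ (d - i).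
  rewrite big_distrr /=; apply: eq_bigr => i _; rewrite Da Db !exprMn.
  have -> : g ^+ d = g ^+ i * g ^+ (d - i) by rewrite -exprD subnKC // -ltnS.
  by ring.
move/eqP; rewrite mulf_eq0 expf_eq0 (negPf g_neq0) andbF /=.
rewrite big_ord_recr /= lead_q subnn mulr1 mul1r addrC addr_eq0 => /eqP Da1.
have b1_dvd : b1 %| a1 ^+ d.
  rewrite Da1 dvdpNr; apply: (big_ind (fun u => b1 %| u)) => [|u v|i _].
  - exact: dvdp0.
  - exact: dvdp_add.
  apply: dvdp_mull; rewrite -(@prednK (d - i)) ?subn_gt0 // exprS.
  exact: dvdp_mulIl.
have : b1 %| 1.
  by rewrite -(Gauss_dvdpr 1 (coprimep_expr d co_b1a1)) mulr1.
rewrite dvdp1 Da Db dvdp_mul2r // => /eqP/eqP; rewrite size_poly_eq1 => /eqp_dvdl ->.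
exact: dvd1p.
Qed.

(** The quotient [c] is a root of [q], so ['X^r - c] divides [q.['X^r]]; for
    large [r] both are monic and the second has its coefficients in [R].  This
    reduces a statement about the ring of polynomials to a factor of one monic
    polynomial over [R], whose coefficients are integral over [R]. *)
Lemma integrally_closed_poly (a b : {poly F}) (q : {poly {poly F}}) :
  normal_domain R -> a \is a polyOver (mem R) -> b \is a polyOver (mem R) ->
  b != 0 -> q \is monic -> (forall i, q`_i \is a polyOver (mem R)) ->
  \sum_(i < size q) q`_i * a ^+ i * b ^+ ((size q).-1 - i) = 0 ->
  exists2 c, c \is a polyOver (mem R) & a = b * c.
Proof.
case=> HR Rnorm Ra Rb b_neq0 mon_q Rq rel.
have /dvdpP[c0 Dc0] := dvdp_of_integral_eqn b_neq0 mon_q rel.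
have [c Dc] : exists c, a = b * c by exists c0; rewrite mulrC.
exists c => // {c0 Dc0}.
have qc0 : root q c.
  apply/eqP; rewrite horner_coef; apply: (mulIf (expf_neq0 (size q).-1 b_neq0)).
  rewrite mul0r -[RHS]rel big_distrl /=; apply: eq_bigr => i _.
  rewrite Dc exprMn; have lei : (i <= (size q).-1)%N.
    by rewrite -ltnS prednK ?size_poly_gt0 ?monic_neq0.
  by rewrite -{1}(subnKC lei) exprD; ring.
(* [r] exceeds the degrees of [c] and of all the coefficients of [q]: then the
   top term of [q.['X^r]] comes from its leading coefficient alone, and
   the coefficients of [c] are, up to sign, those of ['X^r - c] below ['X^r]. *)
pose r := (size c + \max_(i < size q) size (q`_i)%R)%N.
have le_cr : (size c <= r)%N by apply: leq_addr.
have mon_Xr : 'X^r - c \is monic.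
  rewrite monicE lead_coefDl ?lead_coefXn // size_polyXn size_polyN.
  exact: leq_ltn_trans (ltnSn _).
pose S := subring_of HR.
have mon_qXr : q.['X^r] \is monic.
  have q_gt0 : (0 < size q)%N by rewrite size_poly_gt0 monic_neq0.
  have lead_q : q`_(size q).-1 = 1 by apply/eqP; rewrite -monicE.
  rewrite horner_coef -(prednK q_gt0) big_ord_recr /= lead_q mul1r -exprM addrC.
  rewrite monicE lead_coefDl ?lead_coefXn // size_polyXn ltnS.
  apply: (leq_trans (size_sum _ _ _)); apply/bigmax_leqP => i _.
  rewrite -exprM; have [->|qi_neq0] := eqVneq q`_i 0; first by rewrite mul0r size_poly0.
  have lt_iq : (i < size q)%N by rewrite (leq_trans (ltn_ord i)) ?leq_pred.
  have le_r : (size (q`_i)%R <= r)%N.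
    apply: leq_trans (leq_addl _ _).
    exact: (leq_bigmax (F := fun j : 'I_(size q) => size (q`_j)%R) (Ordinal lt_iq)).
  rewrite size_mulXn // (leq_trans (leq_add (leqnn _) le_r)) //.
  by rewrite -mulnSr leq_mul2l ltn_ord orbT.
have R_qXr : q.['X^r] \is a polyOver (mem R).
  change (q.['X^r] \is a polyOver S).
  rewrite horner_coef rpred_sum // => i _.
  by apply: rpredM; [exact: Rq | rewrite rpredX ?polyOverXn].
have dvd_qXr : 'X^r - c %| q.['X^r].
  have /factor_theorem[q' ->] := qc0.
  by rewrite hornerM hornerXsubC dvdp_mulIr.
(* [b * ('X^r - c) = b * 'X^r - a] presents ['X^r - c] as a quotient over [R]. *)
have frac_Xr := quotient_frac_coef (a := b * 'X^r - a) HR _ Rb b_neq0 _.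
have R_Xr i : R ('X^r - c)`_i.
  apply: Rnorm; last exact: (monic_factor_integral HR mon_Xr mon_qXr).
  apply: frac_Xr; last by rewrite Dc mulrBr.
  change (b * 'X^r - a \is a polyOver S).
  by rewrite rpredB ?rpredM // polyOverXn.
change (c \is a polyOver S); apply/polyOverP => i.
apply: mem_set; have := R_Xr i; rewrite coefB coefXn.
have [lt_ic|le_ci] := ltnP i (size c); last first.
  by rewrite nth_default // => _; apply: set_mem (rpred0 S).
rewrite ltn_eqF ?(leq_trans lt_ic) // sub0r => Rc.
apply: set_mem; rewrite -[c`_i]opprK; change (- - c`_i \in S).
by rewrite rpredN; exact: mem_set.
Qed.
End NormalPoly.

(** * Adjoining one transcendental and its inverse *)

Section Adjoin.
Variable F : fieldType.
Implicit Types (R X T : set F) (x : F).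

Lemma subring_closed_set T : T 1 ->
  (forall u v, T u -> T v -> T (u - v)) ->
  (forall u v, T u -> T v -> T (u * v)) -> GRing.subring_closed (mem T).
Proof.
move=> T1 TB TM; split=> [|u v Tu Tv|u v Tu Tv]; apply: mem_set => //.
  by apply: TB; apply: set_mem.
by apply: TM; apply: set_mem.
Qed.

Lemma adjoin_subring R X : GRing.subring_closed (mem (adjoin R X)).
Proof.
have closed T (HT : GRing.subring_closed (mem T)) :
    T 1 /\ forall u v, T u -> T v -> T (u - v) /\ T (u * v).
  split=> [|u v Tu Tv]; first exact: set_mem (rpred1 (subring_of HT)).
  have [Su Sv] : u \in subring_of HT /\ v \in subring_of HT.
    by split; apply: mem_set.
  by split; apply: set_mem; [exact: rpredB Su Sv | exact: rpredM Su Sv].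
apply: subring_closed_set => [T|u v Au Av T|u v Au Av T] [HT sub];
  have [T1 TBM] := closed T HT => //.
  by have [] := TBM u v (Au _ (conj HT sub)) (Av _ (conj HT sub)).
by have [] := TBM u v (Au _ (conj HT sub)) (Av _ (conj HT sub)).
Qed.

Lemma sub_adjoin R X : R `|` X `<=` adjoin R X.
Proof. exact: sub_gen_smallest. Qed.

Lemma adjoin_min R X T : GRing.subring_closed (mem T) ->
  R `<=` T -> X `<=` T -> adjoin R X `<=` T.
Proof. by move=> HT sRT sXT; apply: smallest_sub => //; rewrite subUset. Qed.

End Adjoin.

Section LaurentExtension.
Variables (F : fieldType) (R : set F) (x : F).
Hypothesis Rnorm : normal_domain R.
Hypothesis x_transc :
  forall p : {poly F}, p \is a polyOver (mem R) -> p.[x] = 0 -> p = 0.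

Let HR := Rnorm.1.
Let S := subring_of HR.
Let T := adjoin R [set x; x^-1].

Let x_neq0 : x != 0.
Proof.
apply/eqP => x0; have : 'X = 0 :> {poly F}.
  by apply: x_transc; [exact: (polyOverX S) | rewrite hornerX].
by apply/eqP; rewrite polyX_eq0.
Qed.

Lemma laurent_numerator t : T t ->
  exists c : {poly F} * nat, c.1 \is a polyOver (mem R) /\ t * x ^+ c.2 = c.1.[x].
Proof.
pose U := [set t : F | exists c : {poly F} * nat,
  c.1 \is a polyOver S /\ t * x ^+ c.2 = c.1.[x]].
apply: (@adjoin_min _ _ _ U).
- apply: subring_closed_set => [|u v [[p N] /= [Rp Dp]] [[q M] /= [Rq Dq]]|].
  + by exists (1, 0%N); split; [exact: rpred1 | rewrite /= hornerC expr0 mulr1].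
  + exists (p * 'X^M - q * 'X^N, (N + M)%N); split.
      change (p * 'X^M - q * 'X^N \is a polyOver S).
      by rewrite rpredB ?rpredM ?polyOverXn.
    by rewrite /= !hornerE -Dp -Dq exprD; ring.
  move=> u v [[p N] /= [Rp Dp]] [[q M] /= [Rq Dq]].
  exists (p * q, (N + M)%N); split; first exact: rpredM.
  by rewrite /= hornerM -Dp -Dq exprD; ring.
- move=> u Ru; exists (u%:P, 0%N); split; last by rewrite /= hornerC mulr1.
  by rewrite [_ \is a _]polyOverC; exact: mem_set.
move=> u [->|->].
  by exists ('X, 0%N); split; [exact: polyOverX | rewrite /= hornerX mulr1].
by exists (1, 1%N); split; [exact: rpred1 | rewrite /= hornerC expr1 mulVf].
Qed.

(** If [u = a / b] at [x] is a root of [p], and [x ^+ D] is a common denominator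
    of the coefficients of [p], then [u * x ^+ D] is a root of a monic
    polynomial over [R[x]].  As [x] is transcendental, its equation is an
    identity between polynomials, to which [integrally_closed_poly] applies. *)
Lemma laurent_extension_normal : normal_domain T.
Proof.
have HT : GRing.subring_closed (mem T) := @adjoin_subring _ _ _.
split=> // u [t Tt [s [Ts s_neq0] Du]] [p [mon_p Tp pu0]].
have [[a1 N] /= [Ra1 Da1]] := laurent_numerator Tt.
have [[b1 M] /= [Rb1 Db1]] := laurent_numerator Ts.
pose a := a1 * 'X^M; pose b := b1 * 'X^N.
have Ra : a \is a polyOver S by rewrite rpredM ?polyOverXn.
have Rb : b \is a polyOver S by rewrite rpredM ?polyOverXn.
have bx_neq0 : b.[x] != 0.
  by rewrite hornerM hornerXn -Db1 !mulf_neq0 ?expf_neq0.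
have ax : a.[x] = u * b.[x].
  by rewrite Du !hornerM !hornerXn -Db1 -Da1; field.
have b_neq0 : b != 0 by apply: contraNneq bx_neq0 => ->; rewrite horner0.
clearbody a b; set d := (size p).-1; have p_gt0 : (0 < size p)%N.
  by rewrite size_poly_gt0 monic_neq0.
have num_p i : exists c : {poly F} * nat,
    c.1 \is a polyOver (mem R) /\ p`_i * x ^+ c.2 = c.1.[x].
  apply: laurent_numerator; apply: set_mem.
  by have /polyOverP : p \is a polyOver (subring_of HT) := Tp.
have [c Dc] := choice num_p.
pose D := (\max_(i < size p) (c i).2)%N.
(* These are polynomials with values [p`_i * x ^+ (D * (d - i))], the
   coefficients of the monic polynomial of the root [u * x ^+ D]. *)
pose q : {poly {poly F}} := \poly_(i < size p)
  (if i == d then 1 else (c i).1 * 'X^(D * (d - i) - (c i).2)).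
have lead_q : q`_d = 1 by rewrite coef_poly eqxx /d prednK ?leqnn.
have size_q : size q = size p.
  by rewrite size_poly_eq // eqxx oner_neq0.
have mon_q : q \is monic by rewrite monicE lead_coefE size_q lead_q.
have Rq i : q`_i \is a polyOver S.
  rewrite coef_poly; case: ifP => _; last exact: rpred0.
  case: ifP => _; first exact: rpred1.
  by rewrite rpredM ?polyOverXn //; have [] := Dc i.
have qx i : (i < size p)%N -> (q`_i).[x] = p`_i * x ^+ (D * (d - i)).
  move=> lt_ip; rewrite coef_poly lt_ip; case: eqP => [->|/eqP ne_id].
    by rewrite subnn muln0 mulr1 hornerC; apply/esym/eqP; rewrite -monicE.
  have [_ Di] := Dc i; rewrite hornerM hornerXn -Di -mulrA -exprD subnKC //.
  apply: (@leq_trans D); first exact: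
    (leq_bigmax (F := fun j : 'I_(size p) => (c j).2) (Ordinal lt_ip)).
  rewrite leq_pmulr // subn_gt0 ltn_neqAle ne_id /=.
  by rewrite -ltnS /d prednK.
have RaX : a * 'X^D \is a polyOver S by rewrite rpredM ?polyOverXn.
have rel : \sum_(i < size q) q`_i * (a * 'X^D) ^+ i * b ^+ ((size q).-1 - i) = 0.
  apply: x_transc.
    change (\sum_(i < size q) q`_i * (a * 'X^D) ^+ i * b ^+ ((size q).-1 - i)
            \is a polyOver S).
    apply: rpred_sum => i _; apply: rpredM; last exact: rpredX.
    by apply: rpredM; [exact: Rq | apply: rpredX; exact: RaX].
  suff -> : (\sum_(i < size q) q`_i * (a * 'X^D) ^+ i * b ^+ ((size q).-1 - i)).[x]
      = x ^+ (D * d) * b.[x] ^+ d * p.[u] by rewrite (rootP pu0) mulr0.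
  rewrite size_q -/d horner_sum [p.[u]]horner_coef big_distrr /=; apply: eq_bigr => i _.
  rewrite !hornerM qx // !horner_exp hornerM hornerXn ax.
  have le_id : (i <= d)%N by rewrite -ltnS /d prednK.
  have -> : b.[x] ^+ d = b.[x] ^+ i * b.[x] ^+ (d - i) by rewrite -exprD subnKC.
  have -> : x ^+ (D * d) = x ^+ (D * (d - i)) * (x ^+ D) ^+ i.
    by rewrite -exprM -exprD -mulnDr subnK.
  by rewrite !exprMn; ring.
have [e Re De] := integrally_closed_poly Rnorm RaX Rb b_neq0 mon_q Rq rel.
have Dux : u = e.[x] * x^-1 ^+ D.
  have := congr1 (horner^~ x) De; rewrite !hornerM hornerXn ax => Dux.
  apply: (mulIf bx_neq0); rewrite mulrAC -[e.[x] * _]mulrC -Dux exprVn.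
  by field; rewrite expf_neq0.
pose ST := subring_of HT; apply: set_mem; change (u \in ST); rewrite Dux rpredM //.
  apply: rpred_horner; last by apply: mem_set; apply: sub_adjoin; right; left.
  apply/polyOverP => i; apply: mem_set; apply: sub_adjoin; left; apply: set_mem.
  by have /polyOverP : e \is a polyOver S := Re.
by rewrite rpredX //; apply: mem_set; apply: sub_adjoin; right; right.
Qed.

End LaurentExtension.

(** * Laurent rings of algebraically independent families *)

Section LaurentRing.
Variables (F : fieldType) (R : set F) (n : nat) (x : 'I_n -> F).
Hypothesis HR : GRing.subring_closed (mem R).
Hypothesis x_free : algebraically_independent R x.

Let S := subring_of HR.

Lemma free_neq0 i : x i != 0.
Proof.
apply/eqP => xi0; have /(congr1 (mcoeff U_(i))) : 'X_i = 0 :> mpoly n F.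
  apply: x_free; last by rewrite mevalXU.
  by change ('X_i \is a mpolyOver n S); apply: mpolyOverX.
by rewrite mcoeffX eqxx mcoeff0 => /eqP; rewrite oner_eq0.
Qed.

Definition partial_laurent (s : seq 'I_n) : set F :=
  adjoin R [set y | exists2 i, i \in s & y = x i \/ y = (x i)^-1].

(** The lift [C] must not involve the variables outside [s].  This is expressed
    by evaluation at all points that agree with [x] on [s]; the values are taken
    in [{poly F}] so that one further variable can be kept formal. *)
Definition lifts (s : seq 'I_n) (e : F) (C : mpoly n F) : Prop :=
  C \is a mpolyOver n S /\
  forall v : 'I_n -> {poly F}, (forall j, j \in s -> v j = (x j)%:P) ->
    mmap polyC v C = e%:P.

Lemma partial_laurent_lift s e : partial_laurent s e ->
  exists c : mpoly n F * nat, lifts s (e * (\prod_(j <- s) x j) ^+ c.2) c.1.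
Proof.
set m := \prod_(j <- s) x j; pose M : mpoly n F := \prod_(j <- s) 'X_j.
have M_over : M \is a mpolyOver n S.
  by apply: rpred_prod => j _; apply: mpolyOverX.
have mmapM (v : 'I_n -> {poly F}) : (forall j, j \in s -> v j = (x j)%:P) ->
    mmap polyC v M = m%:P.
  move=> Dv; rewrite rmorph_prod rmorph_prod /=; apply: eq_big_seq => j s_j.
  by rewrite mmapX mmap1U Dv.
apply: (@adjoin_min _ _ _
  [set e | exists c : mpoly n F * nat, lifts s (e * m ^+ c.2) c.1]).
- apply: subring_closed_set => [|u v|u v].
  + exists (1, 0%N); split; first exact: rpred1.
    by move=> v _; rewrite mulr1 rmorph1.
  + move=> [[C N] [/= overC DC]] [[C' N'] [/= overC' DC']].
    exists (C * M ^+ N' - C' * M ^+ N, (N + N')%N); split=> [|w Dw].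
      by change (C * M ^+ N' - C' * M ^+ N \is a mpolyOver n S);
         rewrite rpredB // rpredM ?rpredX.
    rewrite rmorphB !rmorphM !rmorphXn /= DC // DC' // mmapM //.
    by rewrite -!rmorphXn -!rmorphM -rmorphB exprD; congr (_%:P); ring.
  move=> [[C N] [/= overC DC]] [[C' N'] [/= overC' DC']].
  exists (C * C', (N + N')%N); split=> [|w Dw]; first exact: rpredM.
  by rewrite rmorphM /= DC // DC' // -rmorphM exprD; congr (_%:P); ring.
- move=> u Ru; exists (u%:MP, 0%N); split=> [|w _].
    by rewrite [_ \is a _]mpolyOverC; apply: mem_set.
  by rewrite mmapC mulr1.
move=> u [i s_i [->|->]].
  exists ('X_i, 0%N); split=> [|w Dw]; first exact: mpolyOverX.
  by rewrite mmapX mmap1U Dw // mulr1.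
exists (\prod_(j <- rem i s) 'X_j, 1%N); split=> [|w Dw].
  by apply: rpred_prod => j _; apply: mpolyOverX.
rewrite /m expr1 (big_rem i s_i) /= mulKf ?free_neq0 //.
rewrite !rmorph_prod; apply: eq_big_seq => j /mem_rem s_j /=.
by rewrite mmapX mmap1U Dw.
Qed.

Lemma mmap_polyC_const (p : mpoly n F) :
  mmap polyC (fun j => (x j)%:P) p = (p.@[x])%:P.
Proof.
rewrite mevalE rmorph_sum; apply: eq_bigr => k _.
by rewrite rmorphM rmorph_prod; congr (_ * _); apply: eq_bigr => j _; rewrite rmorphXn.
Qed.

(** A relation [p.[x i] = 0] lifts, after clearing denominators, to a polynomial
    [P] that vanishes at [x], so [P = 0].  Evaluating [P] with the [i]-th
    variable kept formal and the others at [x] recovers [p], up to a nonzero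
    constant. *)
Lemma partial_laurent_transcendental s i (p : {poly F}) : i \notin s ->
  p \is a polyOver (mem (partial_laurent s)) -> p.[x i] = 0 -> p = 0.
Proof.
move=> s'i Lp pxi0; set m := \prod_(j <- s) x j.
have m_neq0 : m != 0 by rewrite prodf_seq_neq0; apply/allP => j _; apply: free_neq0.
have num_p j : exists c : mpoly n F * nat, lifts s (p`_j * m ^+ c.2) c.1.
  apply: partial_laurent_lift; apply: set_mem.
  have HL : GRing.subring_closed (mem (partial_laurent s)) := @adjoin_subring _ _ _.
  by have /polyOverP : p \is a polyOver (subring_of HL) := Lp.
have [c Dc] := choice num_p.
pose N := (\max_(j < size p) (c j).2)%N.
pose P : mpoly n F := \sum_(j < size p)
  (c j).1 * (\prod_(k <- s) 'X_k) ^+ (N - (c j).2) * 'X_i ^+ j.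
have P_over : P \is a mpolyOver n S.
  apply: rpred_sum => j _; apply: rpredM; last exact/rpredX/mpolyOverX.
  apply: rpredM; first by case: (Dc j).
  by apply/rpredX/rpred_prod => k _; apply: mpolyOverX.
have mmapP v : (forall j, j \in s -> v j = (x j)%:P) ->
    mmap polyC v P = (m ^+ N)%:P * (p \Po v i).
  move=> Dv; rewrite comp_polyE big_distrr rmorph_sum; apply: eq_bigr => j _.
  rewrite !rmorphM !rmorphXn /= mmapX mmap1U rmorph_prod.
  rewrite (eq_big_seq (fun k => (x k)%:P)); last first.
    by move=> k s_k; rewrite /= mmapX mmap1U Dv.
  rewrite -rmorph_prod -/m; have [_ ->//] := Dc j.
  have le_jN : ((c j).2 <= N)%N.
    exact: (leq_bigmax (F := fun k : 'I_(size p) => (c k).2)).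
  rewrite -(subnKC le_jN) exprD -mul_polyC -!rmorphXn /= -!polyCM mulrA -!polyCM.
  by congr (_%:P * _); rewrite subnKC //; ring.
have P0 : P = 0.
  apply: x_free => //; apply: (polyC_inj); rewrite -mmap_polyC_const mmapP //.
  by rewrite comp_polyCr pxi0 mulr0.
have := mmapP (fun j => if j == i then 'X else (x j)%:P); rewrite P0 rmorph0 eqxx.
rewrite comp_polyXr => H; have := H _; move/(_ _)/esym/eqP.
rewrite mulf_eq0 polyC_eq0 expf_eq0 (negPf m_neq0) andbF /= => H1; apply/eqP; apply: H1.
by move=> j s_j; case: eqP s_j s'i => [->|//] ->.
Qed.

Lemma partial_laurent_normal s : normal_domain R -> uniq s ->
  normal_domain (partial_laurent s).
Proof.
move=> Rnorm; elim: s => [_|i s IHs /= /andP[s'i uniq_s]].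
  suff -> : partial_laurent [::] = R by [].
  apply/seteqP; split=> [|u Ru]; last by apply: sub_adjoin; left.
  by apply: adjoin_min => // u [].
suff -> : partial_laurent (i :: s) =
          adjoin (partial_laurent s) [set x i; (x i)^-1].
  apply: laurent_extension_normal; first exact: IHs.
  by move=> p; apply: partial_laurent_transcendental.
apply/seteqP; split; (apply: adjoin_min; first exact: adjoin_subring).
- by move=> u Ru; apply: sub_adjoin; left; apply: sub_adjoin; left.
- move=> u [j]; rewrite inE => /predU1P[-> Du|s_j Du]; apply: sub_adjoin.
    by right; case: Du => ->; [left|right].
  by left; apply: sub_adjoin; right; exists j.
- apply: adjoin_min; first exact: adjoin_subring.
    by move=> u Ru; apply: sub_adjoin; left.
  move=> u [j s_j Du]; apply: sub_adjoin; right; exists j => //.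
  by rewrite inE s_j orbT.
by move=> u Du; apply: sub_adjoin; right; exists i; rewrite ?mem_head.
Qed.

End LaurentRing.

Lemma laurent_ring_normal (F : fieldType) (R : set F) n (x : 'I_n -> F) :
  normal_domain R -> algebraically_independent R x ->
  normal_domain (laurent_ring R x).
Proof.
move=> Rnorm x_free.
suff -> : laurent_ring R x = partial_laurent R x (enum 'I_n).
  by apply: partial_laurent_normal => //; [exact: Rnorm.1 | exact: enum_uniq].
congr adjoin; apply/seteqP; split=> u.
  by case=> [] [i _ <-]; exists i; rewrite ?mem_enum //; [left|right].
by case=> i _ [->|->]; [left|right]; exists i.
Qed.

(** * Mutation preserves algebraic independence *)

(** Write [mut] for the exchange of the [k]-th coordinate.  Clearing the powers
    of [c * v k] in [p.@[mut v]] gives a polynomial [q] with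
    [q.@[v] = (c * v k) ^+ D * p.@[mut v]] at every [v] with [v k != 0].  Taking
    [v = x] shows [q = 0] by independence of [x]; taking [v = mut x], where
    [mut v = x], then shows [p.@[x] = 0]. *)
Lemma exchange_free (F : fieldType) (R : set F) n (x : 'I_n -> F) k
    (E : mpoly n F) (c : F) :
  GRing.subring_closed (mem R) -> algebraically_independent R x ->
  E \is a mpolyOver n (mem R) -> R c -> c != 0 -> E.@[x] != 0 ->
  (forall v w : 'I_n -> F, (forall j, j != k -> v j = w j) -> E.@[v] = E.@[w]) ->
  algebraically_independent R
    (fun i => if i == k then E.@[x] / (c * x k) else x i).
Proof.
move=> HR x_free overE Rc c_neq0 Ex_neq0 Ek p over_p.
pose S := subring_of HR.
pose mut v i := if i == k then E.@[v] / (c * v k) else v i : F.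
rewrite -/(mut x) => px'0.
have xk_neq0 := free_neq0 HR x_free k.
pose D := (\max_(m <- msupp p) m k)%N.
pose q : mpoly n F := \sum_(m <- msupp p) p@_m *:
  (E ^+ m k * (c *: 'X_k) ^+ (D - m k) * \prod_(j | j != k) 'X_j ^+ m j).
have q_eval v : v k != 0 -> q.@[v] = (c * v k) ^+ D * p.@[mut v].
  move=> vk_neq0; rewrite rmorph_sum (mevalE (mut v)) big_distrr /=.
  apply: eq_big_seq => m p_m.
  rewrite mevalZ !rmorphM !rmorphXn /= mevalZ mevalXU rmorph_prod.
  rewrite [in RHS](bigD1 k) //= /mut eqxx.
  rewrite [X in _ * (_ * X) = _](eq_bigr (fun j => v j ^+ m j)); last first.
    by move=> j _; rewrite rmorphXn /= mevalXU.
  rewrite [X in _ = _ * (_ * (_ * X))](eq_bigr (fun j => v j ^+ m j)); last first.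
    by move=> j /negPf->.
  have le_mD : (m k <= D)%N by rewrite /D (big_rem _ p_m) leq_maxl.
  have -> : (c * v k) ^+ D = (c * v k) ^+ (D - m k) * (c * v k) ^+ m k.
    by rewrite -exprD subnK.
  have cv_neq0 : c * v k != 0 by rewrite mulf_neq0.
  have := expf_neq0 (m k) cv_neq0; rewrite [(_ / _) ^+ _]expr_div_n.
  move: ((c * v k) ^+ m k) ((c * v k) ^+ (D - m k)) (E.@[v] ^+ m k) (p@_m)
    (\prod_(j | _) _) => w w' e pm z w_neq0.
  by field.
have over_q : q \is a mpolyOver n S.
  apply: rpred_sum => m _; apply: mpolyOverZ.
    by have /mpolyOverP : p \is a mpolyOver n S := over_p.
  apply: rpredM; last by apply: rpred_prod => j _; apply/rpredX/mpolyOverX.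
  apply: rpredM; first by apply: rpredX; exact: overE.
  by apply/rpredX/mpolyOverZ/mpolyOverX; apply: mem_set.
have q0 : q = 0 by apply: x_free => //; rewrite q_eval // px'0 mulr0.
have x'k : mut x k = E.@[x] / (c * x k) by rewrite /mut eqxx.
have x'k_neq0 : mut x k != 0 by rewrite x'k !(mulf_neq0, invr_neq0).
have mutK : mut (mut x) =1 x.
  move=> i; rewrite {1}/mut; case: eqP => [->|/eqP/negPf ik].
    rewrite (Ek (mut x) x) => [|j /negPf jk]; last by rewrite /mut jk.
    by rewrite x'k; field; rewrite xk_neq0 c_neq0.
  by rewrite /mut ik.
apply: x_free => //; have := q_eval _ x'k_neq0; rewrite q0 meval0.
move/esym/eqP; rewrite mulf_eq0 expf_eq0 mulf_eq0 (negPf c_neq0) (negPf x'k_neq0).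
by rewrite andbF (meval_eq _ mutK) => /eqP.
Qed.

Lemma skew_symmetrizableP n (B : 'M[int]_n) : skew_symmetrizable B <->
  exists d : 'rV[int]_n, (forall i, 0 < d 0 i) /\
    forall i j, d 0 i * B i j = - (d 0 j * B j i).
Proof.
split=> -[d [d_gt0 dB]]; exists d; split=> //.
  move=> i j; have /matrixP/(_ j i) := dB.
  by rewrite mxE [X in _ = X]mxE !mul_diag_mx !mxE.
by apply/matrixP => i j; rewrite mxE [in RHS]mxE !mul_diag_mx !mxE dB.
Qed.

Lemma skew_symmetrizable_diag n (B : 'M[int]_n) k :
  skew_symmetrizable B -> B k k = 0.
Proof.
move/skew_symmetrizableP=> [d [d_gt0 dB]]; have /eqP := dB k k.
rewrite -addr_eq0 -mulr2n mulrn_eq0 mulf_eq0 (gt_eqF (d_gt0 k)) /=.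
by move/eqP.
Qed.

(** The correction terms of matrix mutation at [(i, j)] and [(j, i)] are
    opposite once scaled by the symmetrizer: multiplied by it, both are
    expressed through the row [k]. *)
Lemma mutation_term_skew (K : realDomainType) (di dj dk bik bki bjk bkj : K) :
  0 < di -> 0 < dj -> 0 < dk ->
  di * bik = - (dk * bki) -> dj * bjk = - (dk * bkj) ->
  di * (`|bik| * bkj + bik * `|bkj|) = - (dj * (`|bjk| * bki + bjk * `|bki|)).
Proof.
move=> di0 dj0 dk0 Eik Ejk.
have Nik : di * `|bik| = dk * `|bki|.
  by rewrite -{1}(gtr0_norm di0) -{1}(gtr0_norm dk0) -!normrM Eik normrN.
have Njk : dj * `|bjk| = dk * `|bkj|.
  by rewrite -{1}(gtr0_norm dj0) -{1}(gtr0_norm dk0) -!normrM Ejk normrN.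
by rewrite !mulrDr !mulrA Nik Eik Njk Ejk; ring.
Qed.

Lemma mutate_matrix_skew n k (B : 'M[int]_n) :
  skew_symmetrizable B -> skew_symmetrizable (mutate_matrix k B).
Proof.
move/skew_symmetrizableP=> [d [d_gt0 dB]]; apply/skew_symmetrizableP.
exists d; split=> // i j; rewrite !mxE orbC.
case: ifP => _; first by rewrite !mulrN dB.
(* The division by 2 in the definition of mutation is exact. *)
have half a b : (((`|a| * b + a * `|b|) %/ 2)%Z) * 2 = `|a| * b + a * `|b| :> int.
  apply/divzK/dvdzP.
  case: (leP 0 a) => a0; case: (leP 0 b) => b0;
    rewrite ?(ger0_norm a0) ?(ltr0_norm a0) ?(ger0_norm b0) ?(ltr0_norm b0).
  - by exists (a * b); ring.
  - by exists 0; ring.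
  - by exists 0; ring.
  - by exists (- (a * b)); ring.
apply: (mulIf (_ : 2%Z != 0)) => //.
rewrite mulNr -!mulrA !mulrDl !half.
have := mutation_term_skew (d_gt0 i) (d_gt0 j) (d_gt0 k) (dB i k) (dB j k).
by rewrite mulrDr => ->; rewrite mulrA dB; ring.
Qed.

(** * Clusters of mutation equivalent seeds *)

Section SeedMutation.
Variables (P : semifieldType) (F : fieldType).
Variable iota : {rmorphism group_ring P -> F}.
Hypothesis iota_inj : injective iota.
Variable n : nat.
Implicit Types S : seed P F n.

(** An invariant of mutation.  Independence is asked over the group ring itself,
    where denominators can be cleared, so that no fractions of coefficients
    appear. *)
Definition independent_seed S : Prop :=
  skew_symmetrizable (exchange_matrix S) /\
  algebraically_independent (range iota) (cluster S).

Lemma range_subring : GRing.subring_closed (mem (range iota)).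
Proof.
apply: subring_closed_set; first by exists 1; rewrite ?rmorph1.
  by move=> _ _ [f _ <-] [g _ <-]; exists (f - g); rewrite ?rmorphB.
by move=> _ _ [f _ <-] [g _ <-]; exists (f * g); rewrite ?rmorphM.
Qed.

Lemma gr_elt_neq0 (p : P) : gr_elt p != 0.
Proof. by rewrite monalg.monalgU_eq0. Qed.

Lemma gr_eltD1_neq0 (p : P) : gr_elt p + 1 != 0.
Proof.
apply/eqP => /(congr1 (monalg.mcoeff p)) /eqP.
rewrite monalg.mcoeffD monalg.mcoeff0 !monalg.mcoeffU eqxx.
by case: (1%g == p).
Qed.

Lemma iota_neq0 f : f != 0 -> iota f != 0.
Proof. by rewrite -(inj_eq iota_inj) rmorph0. Qed.

(** If both monomials coincide, the binomial is [y + 1] times that monomial, and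
    [y + 1] is a sum of group elements with nonnegative coefficients. *)
Lemma exchange_binomial_neq0 (y : P) (a b : 'I_n -> nat) :
  (iota (gr_elt y))%:MP * \prod_j 'X_j ^+ a j + \prod_j 'X_j ^+ b j
    != 0 :> mpoly n F.
Proof.
have monE (e : 'I_n -> nat) :
    \prod_j 'X_j ^+ e j = 'X_[[multinom e j | j < n]] :> mpoly n F.
  by rewrite [RHS]mpolyXE_id; apply: eq_bigr => j _; rewrite mnmE.
apply/eqP => /(congr1 (mcoeff [multinom a j | j < n])).
rewrite !monE mcoeffD mcoeffCM !mcoeffX eqxx mulr1 mcoeff0 => /eqP.
case: ([multinom b j | j < n] == _); last first.
  by rewrite addr0 (negPf (iota_neq0 (gr_elt_neq0 y))).
by rewrite -(rmorph1 iota) -rmorphD (negPf (iota_neq0 (gr_eltD1_neq0 y))).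
Qed.

Lemma is_seed_independent S : is_seed iota S -> independent_seed S.
Proof.
move=> [skewB [free _]]; split=> // p over_p; apply: free.
apply: mpolyOverS over_p => u /set_mem Ru; apply: mem_set.
exists u => //; exists 1; last by rewrite divr1.
by split; [exists 1; rewrite ?rmorph1 | exact: oner_neq0].
Qed.

Lemma mutate_independent k S : independent_seed S -> independent_seed (mutate iota k S).
Proof.
case: S => B x y [/= skewB free]; split; first exact: mutate_matrix_skew.
have Bkk := skew_symmetrizable_diag k skewB.
pose E : mpoly n F := (iota (gr_elt (y k)))%:MP * \prod_j 'X_j ^+ pos_part (B j k)
                      + \prod_j 'X_j ^+ pos_part (- B j k).
have evalE v : E.@[v] = iota (gr_elt (y k)) * \prod_j v j ^+ pos_part (B j k)
                        + \prod_j v j ^+ pos_part (- B j k).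
  rewrite mevalD mevalM mevalC !rmorph_prod /=.
  by congr (_ * _ + _); apply: eq_bigr => j _; rewrite rmorphXn /= mevalXU.
have overE : E \is a mpolyOver n (subring_of range_subring).
  apply: rpredD; last by apply: rpred_prod => j _; apply/rpredX/mpolyOverX.
  apply: rpredM; last by apply: rpred_prod => j _; apply/rpredX/mpolyOverX.
  by rewrite [_ \in _]mpolyOverC; apply: mem_set; exists (gr_elt (y k)).
have /= := @exchange_free F (range iota) n x k E (iota (gr_elt (y k ⊕ 1)%g))
  range_subring free overE.
rewrite /mutate_cluster /= -evalE; apply.
- by exists (gr_elt (y k ⊕ 1)%g).
- exact/iota_neq0/gr_elt_neq0.
- apply/eqP => Ex0; have /eqP : E = 0 by apply: free.
  by apply/negP/exchange_binomial_neq0.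
move=> v w vw; rewrite !evalE; congr (_ * _ + _); apply: eq_bigr => j _.
  by have [->|/vw->//] := eqVneq j k; rewrite Bkk.
by have [->|/vw->//] := eqVneq j k; rewrite Bkk.
Qed.

End SeedMutation.

(** * Normality of the upper cluster algebra *)

Lemma bigcap_normal (F : fieldType) I (D : set I) (L : I -> set F) :
  (forall i, D i -> normal_domain (L i)) -> normal_domain (\bigcap_(i in D) L i).
Proof.
move=> Lnorm; split.
  apply: subring_closed_set => [|u v Lu Lv|u v Lu Lv] i Di;
    have [HL _] := Lnorm i Di; pose S := subring_of HL; apply: set_mem.
  - exact: (rpred1 S).
  - by apply: (@rpredB _ S); apply: mem_set; [apply: Lu | apply: Lv].
  - by apply: (@rpredM _ S); apply: mem_set; [apply: Lu | apply: Lv].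
move=> u [a La [b [Lb b_neq0] Du]] [p [mon_p Lp pu0]] i Di.
apply: (Lnorm i Di).2; first by exists a;
  [exact: La | exists b => //; split; [exact: Lb|]].
exists p; split=> //; move/allP: Lp => Lp; apply/allP => c /Lp/set_mem Lc.
by apply: mem_set; exact: Lc.
Qed.

Theorem proposition2p1 (P : semifieldType) (F : fieldType)
    (iota : {rmorphism group_ring P -> F}) (iota_inj : injective iota)
    (n : nat) (S : seed P F n) (S_seed : is_seed iota S)
    (A : set (group_ring P)) (A_subring : GRing.subring_closed (mem A))
    (A_laurent : laurent_phenomenon iota A S)
    (A_coefficients : coefficient_condition iota A S)
    (A_normal : normal_domain (iota @` A)) :
  normal_domain (upper_cluster_algebra iota A S).
Proof.
apply: bigcap_normal => _ [ks [s ->]].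
set T := foldl _ S ks.
have [_ free] : independent_seed iota T.
  have := is_seed_independent S_seed; rewrite {}/T.
  elim: ks S {S_seed A_laurent A_coefficients} => //= k ks IHks S.
  by move=> /(mutate_independent iota_inj k)/IHks.
(* Permuting the indices does not change the set of cluster variables. *)
have -> : laurent_ring (iota @` A) (cluster (permute_seed s T)) =
          laurent_ring (iota @` A) (cluster T).
  have reindex (g : 'I_n -> F) : range (g \o s) = range g.
    apply/seteqP; split=> _ [i _ <-]; first by exists (s i).
    by exists ((s^-1)%g i) => //=; rewrite permKV.
  rewrite /laurent_ring /= reindex.
  by rewrite -[in RHS](reindex (fun i => (cluster T i)^-1)).
apply: laurent_ring_normal => // p over_p; apply: free.
by apply: mpolyOverS over_p => u /set_mem[f _ <-]; apply: mem_set; exists f.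
Qed.
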